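(* For all real numbers $\epsilon,\epsilon'$ with $0<\epsilon\leqslant\epsilon'\leqslant 2$, the natural inclusion $B_\epsilon\hookrightarrow B_{\epsilon'}$ is a homotopy equivalence.
   Context: Let $A=(0,0,0)$ and $B=(1,0,0)$ in $\mathbb{R}^3$. A rope is a non-singular $C^1$-smooth embedding $r:[0,1]\to\mathbb{R}^3$ with $r(0)=A$ and $r(1)=B$ (non-singularity includes the condition that the tangent vectors $\frac{dr}{dt}(0)$ and $\frac{dr}{dt}(1)$ are non-zero). The space of all ropes with the $C^1$-topology is $B_\infty$. For $\epsilon>0$, $B_\epsilon\subset B_\infty$ is the subspace of ropes of length strictly less than $1+\epsilon$. *)

(* Defs.v *)
From HB Require Import structures.
From mathcomp Require Import all_boot all_order all_algebra.
From mathcomp Require Import all_classical all_reals all_analysis.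
Set Implicit Arguments.
Unset Strict Implicit.
Unset Printing Implicit Defensive.
Import Order.TTheory GRing.Theory Num.Theory.
Import numFieldNormedType.Exports.
Local Open Scope classical_set_scope.
Local Open Scope ring_scope.

Notation I01 R := (set_type (`[0%R, 1%R]%classic : set R)).

Section I01_endpoints.
Variable R : realType.

Lemma I01_0_subproof : (0 : R) \in (`[0, 1]%classic : set R).
Proof. by rewrite inE /= in_itv /= lexx ler01. Qed.

Lemma I01_1_subproof : (1 : R) \in (`[0, 1]%classic : set R).
Proof. by rewrite inE /= in_itv /= lexx ler01. Qed.

Definition I01_0 : I01 R := exist _ 0 I01_0_subproof.
Definition I01_1 : I01 R := exist _ 1 I01_1_subproof.

End I01_endpoints.

Section homotopy_equivalence.
Variable R : realType.

Definition homotopic (X Y : topologicalType) (f g : X -> Y) : Prop :=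
  exists H : X * I01 R -> Y,
    [/\ continuous H,
        forall x, H (x, I01_0 R) = f x &
        forall x, H (x, I01_1 R) = g x].

Definition homotopy_equivalence (X Y : topologicalType) (f : X -> Y) : Prop :=
  continuous f /\
  exists g : Y -> X,
    [/\ continuous g, homotopic (g \o f) id & homotopic (f \o g) id].

End homotopy_equivalence.

Definition topological_embedding (X Y : topologicalType) (f : X -> Y) : Prop :=
  injective f /\
  (forall U : set X, open U <-> exists2 W : set Y, open W & f @^-1` W = U).

Section ropes.
Variable R : realType.
Notation I := (I01 R).
Notation V := 'rV[R]_3.

Definition pointA : V := 0.
Definition pointB : V := delta_mx 0 0.

(* The norm `|v| of 'rV[R]_3 is the sup norm: it gives the right topology and
   uniformity, but lengths require the Euclidean norm. *)
Definition enorm (v : V) : R := Num.sqrt (\sum_(j < 3) v 0 j ^+ 2).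

(* The punctured neighborhoods t^' are taken in the space [0, 1], so that
   derivatives at the endpoints are one-sided. *)
Definition diff_quotient (r : I -> V) (t s : I) : V :=
  (val s - val t)^-1 *: (r s - r t).

Definition deriv01 (r : I -> V) (t : I) : V :=
  lim (diff_quotient r t @ t^').

Definition is_C1 (r : I -> V) : Prop :=
  (forall t, cvg (diff_quotient r t @ t^')) /\ continuous (deriv01 r).

Definition is_rope (r : I -> V) : Prop :=
  [/\ is_C1 r,
      topological_embedding r,
      (forall t, deriv01 r t != 0),
      r (I01_0 R) = pointA &
      r (I01_1 R) = pointB].

Definition rope := set_type [set r : I -> V | is_rope r].

(* The C^1-topology is uniform convergence of r together with r'. *)
Definition rope_jet (r : rope) : {uniform I -> V} * {uniform I -> V} :=
  (val r, deriv01 (val r)).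

Definition Binfty := initial_topology rope_jet.
HB.instance Definition _ := Topological.copy Binfty (initial_topology rope_jet).

Definition rope_length (r : Binfty) : R :=
  \int[lebesgue_measure]_(t in `[0, 1])
     enorm ('valL_0 (deriv01 (val (r : rope))) t).

Definition B_ (eps : R) : set Binfty := [set r | rope_length r < 1 + eps].

Lemma B_subset (eps eps' : R) : eps <= eps' -> B_ eps `<=` B_ eps'.
Proof. by move=> le r /lt_le_trans; apply; rewrite lerD2l. Qed.

Definition B_inclusion (eps eps' : R) (le : eps <= eps') :
    set_type (B_ eps) -> set_type (B_ eps') :=
  subfun (B_subset le).

End ropes.

(* Main.v *)
Require Import Defs.
From mathcomp Require Import all_boot all_order all_algebra.
From mathcomp Require Import all_classical all_reals all_analysis.
From mathcomp Require Import ring lra.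

(** Let x be the first coordinate of a rope r, and let g(t) be the infimum over
    s of the slope (x(s) - x(t)) / (s - t), read as x'(t) when s = t.  The gauge
    max(0, g) is continuous and depends continuously on r; where it is positive,
    x' > 0 and x(t) separates the earlier values of x from the later ones.
    Hence its normalized primitive F increases only where x does, and
    (1 - s) r + s F e_1 is a rope for 0 <= s < 1, of length at most
    (1 - s) L + s.  This deforms B_eps' into B_eps, every B_d being preserved.

    The primitive can be normalized because L < 3.  If the gauge vanishes
    identically, then for each e > 0 the function y(t) = x(t) - e t has, around
    each t, points a <= t <= b with y(a) > y(b).  Such a y has positive
    variation at least 2 (y(1) - y(0)), so total variation at least
    3 (y(1) - y(0)), and L >= 3 follows as e tends to 0. *)

Set Implicit Arguments.
Unset Strict Implicit.
Unset Printing Implicit Defensive.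
Import Order.TTheory GRing.Theory Num.Theory.
Import numFieldNormedType.Exports.
Local Open Scope classical_set_scope.
Local Open Scope ring_scope.

(** * Primitives of continuous functions on the line *)

Section antiderivative.
Variable R : realType.
Implicit Types (f g : R -> R) (a b e t : R).

(** The mean value theorem for [G - F]. Derivatives are asked for only in the open interval, so
    functions with one-sided derivatives at the ends can be compared; used in both directions, this
    identifies two primitives. *)
Lemma le_increment (F G f g : R -> R) a b : a <= b ->
  (forall x, x \in `]a, b[ -> is_derive x 1 F (f x)) ->
  (forall x, x \in `]a, b[ -> is_derive x 1 G (g x)) ->
  {within `[a, b], continuous F} -> {within `[a, b], continuous G} ->
  (forall x, x \in `]a, b[ -> f x <= g x) ->
  F b - F a <= G b - G a.
Proof.
rewrite le_eqVlt => /predU1P[->|ab] dF dG cF cG fg; first by rewrite !subrr.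
have [||c cab /=] := @MVT R (G - F) (g \- f) a b ab.
- by move=> x xab; apply: is_deriveB; [exact: dG|exact: dF].
- by move=> x; apply: (@continuousB _ _ (subspace `[a, b])); [exact: cG|exact: cF].
rewrite !fctE => E.
have : 0 <= (g c - f c) * (b - a).
  by rewrite mulr_ge0// ?subr_ge0 ?fg// ltW.
by rewrite -E; lra.
Qed.

(* The base point -1 makes the interval [0, 1] interior to the domain of
   integration, so that no one-sided derivative occurs. *)
Definition antideriv f t : R :=
  \int[lebesgue_measure]_(x in `[-1, t]) f x -
  \int[lebesgue_measure]_(x in `[-1, 0]) f x.

Lemma antideriv0 f : antideriv f 0 = 0.
Proof. by rewrite /antideriv subrr. Qed.

Lemma is_derive_antideriv f t : continuous f -> -1 < t ->
  is_derive t 1 (antideriv f) (f t).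
Proof.
move=> cf t1.
have [||dF F'] := @continuous_FTC1_closed R f (-1) t (t + 1) _ _ t1 (cf t).
- by rewrite ltrDl.
- apply: continuous_compact_integrable; first exact: segment_compact.
  exact: continuous_subspaceT.
rewrite /antideriv -[f t]subr0.
apply: (@is_deriveB _ _ _ _ (cst _)).
by split; [exact: dF|rewrite -derive1E].
Qed.

Lemma is_derive_continuous (F : R -> R) t l : is_derive t 1 F l ->
  {for t, continuous F}.
Proof.
by move=> [dF _]; apply: differentiable_continuous; apply/derivable1_diffP.
Qed.

Lemma continuous_antideriv f t : continuous f -> -1 < t ->
  {for t, continuous (antideriv f)}.
Proof.
by move=> cf t1; apply: is_derive_continuous (is_derive_antideriv cf t1).
Qed.

Lemma within_continuous_antideriv f a b : continuous f -> -1 < a ->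
  {within `[a, b], continuous (antideriv f)}.
Proof.
move=> cf a1; apply: continuous_in_subspaceT => x.
rewrite inE/= in_itv/= => /andP[ax _]; apply: continuous_antideriv => //.
exact: lt_le_trans ax.
Qed.

(** Sign, constant and distance bounds on integrals reduce to evaluating the integrand at this
    [c]. *)
Lemma antideriv_mvt f a b : continuous f -> 0 <= a -> a <= b ->
  exists2 c, a <= c <= b & antideriv f b - antideriv f a = f c * (b - a).
Proof.
move=> cf a0 ab; have [||c] := @MVT_segment R (antideriv f) f a b ab.
- move=> x; rewrite in_itv/= => /andP[ax _].
  by apply: is_derive_antideriv => //; lra.
- by apply: within_continuous_antideriv => //; lra.
by rewrite in_itv/= => cab E; exists c.
Qed.

Lemma le_antideriv f g a b : continuous f -> continuous g ->
  0 <= a -> a <= b -> (forall x, a <= x <= b -> f x <= g x) ->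
  antideriv f b - antideriv f a <= antideriv g b - antideriv g a.
Proof.
move=> cf cg a0 ab fg; apply: (@le_increment _ _ f g) => //.
- by move=> x; rewrite in_itv/= => /andP[ax _]; apply: is_derive_antideriv => //; lra.
- by move=> x; rewrite in_itv/= => /andP[ax _]; apply: is_derive_antideriv => //; lra.
- by apply: within_continuous_antideriv => //; lra.
- by apply: within_continuous_antideriv => //; lra.
by move=> x; rewrite in_itv/= => /andP[ax xb]; apply: fg; rewrite !ltW.
Qed.

Lemma antideriv_nondecreasing f a b : continuous f -> 0 <= a -> a <= b ->
  (forall x, a <= x <= b -> 0 <= f x) -> antideriv f a <= antideriv f b.
Proof.
move=> cf a0 ab f0; have [c cab E] := antideriv_mvt cf a0 ab.
by rewrite -subr_ge0 E mulr_ge0 ?f0// subr_ge0.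
Qed.

Lemma antideriv_cst (k : R) t : 0 <= t -> antideriv (cst k) t = k * t.
Proof.
move=> t0; have [|c _] := @antideriv_mvt (cst k) 0 t _ (lexx _) t0.
  by move=> x; exact: cst_continuous.
by rewrite antideriv0 !subr0.
Qed.

Lemma continuous_lin (k l : R) f g : continuous f -> continuous g ->
  continuous (fun x => k * f x + l * g x).
Proof.
move=> cf cg x; apply: (@continuousD _ _ _ (fun x => k * f x)
  (fun x => l * g x)); apply: continuousM; by
  [exact: cst_continuous|exact: cf|exact: cg].
Qed.

Lemma antideriv_lin (k l : R) f g t : continuous f -> continuous g -> 0 <= t ->
  antideriv (fun x => k * f x + l * g x) t = k * antideriv f t + l * antideriv g t.
Proof.
move=> cf cg t0.
have ch : continuous (fun x => k * f x + l * g x).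
  exact: continuous_lin.
(* [D] has derivative zero to the right of -1 and vanishes at 0. *)
pose D : R -> R := antideriv (fun x => k * f x + l * g x) -
  (k *: antideriv f + l *: antideriv g).
have dD (x : R) : -1 < x -> is_derive x 1 D 0.
  move=> x1; have H1 := is_derive_antideriv cf x1.
  have H2 := is_derive_antideriv cg x1.
  have H3 := is_derive_antideriv ch x1.
  have H4 := is_deriveB H3 (is_deriveD (is_deriveZ k H1) (is_deriveZ l H2)).
  by apply: is_derive_eq; rewrite /GRing.scale/= subrr.
have [||c _] := @MVT_segment R D (cst 0) 0 t t0.
- by move=> x; rewrite in_itv/= => /andP[ax _]; apply: dD; lra.
- apply: continuous_in_subspaceT => x.
  rewrite inE/= in_itv/= => /andP[ax _].
  by apply: (is_derive_continuous (dD _ _)); lra.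
rewrite /D !fctE !antideriv0 /GRing.scale/= mul0r; lra.
Qed.

Lemma antideriv_dist f g e t : continuous f -> continuous g -> 0 <= t <= 1 ->
  (forall x, 0 <= x <= 1 -> `|f x - g x| <= e) ->
  `|antideriv f t - antideriv g t| <= e.
Proof.
move=> cf cg /andP[t0 t1] fg.
have e0 : 0 <= e by apply: le_trans (fg 0 _) => //; rewrite lexx ler01.
have ch : continuous (fun x => 1 * f x + (-1) * g x).
  exact: continuous_lin.
have [c /andP[c0 ct]] := antideriv_mvt ch (lexx _) t0.
rewrite antideriv0 !subr0 antideriv_lin// !mul1r !mulN1r => ->.
rewrite normrM (ger0_norm t0).
have : `|f c - g c| <= e by apply: fg; rewrite c0 (le_trans ct).
by move=> /(ler_pM (normr_ge0 _) t0) => /(_ 1 t1); rewrite mulr1.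
Qed.

End antiderivative.

(** * Chord slopes, extended across the diagonal *)

Section slopes.
Variable R : realType.
Implicit Types (f g : R -> R) (a b e s t : R).

(** Heine's theorem through the near-covering form of compactness: around each point of [0, 1] all
    small radii work for all neighbours, and compactness provides a common radius. *)
Lemma itv01_uniform_continuity f e : continuous f -> 0 < e ->
  exists2 d, 0 < d & forall s t, 0 <= s <= 1 -> 0 <= t <= 1 ->
    `|s - t| < d -> `|f s - f t| < e.
Proof.
move=> cf e0.
have /compact_near_coveringP cov := @segment_compact R 0 1.
have [] := cov R (0^'+) (fun d x => forall y, `|x - y| < d -> `|f x - f y| < e) _.
  move=> x _.
  have e20 : 0 < e / 2 by lra.
  have /cvgrPdist_lt/(_ _ e20)[/= d d0 fd] := cf x.
  have d20 : 0 < d / 2 by lra.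
  near=> x' i => y /= xy.
  have X : `|x - x'| < d / 2.
    by near: x'; exists (d / 2).
  have I : i < d / 2 by near: i; exact: nbhs_right_lt.
  have H1 : `|f x - f x'| < e / 2 by apply: fd => /=; lra.
  have H2 : `|f x - f y| < e / 2.
    apply: fd => /=; rewrite (_ : x - y = (x - x') + (x' - y)); last by ring.
    by apply: le_lt_trans (ler_normD _ _) _; lra.
  rewrite (_ : f x' - f y = (f x - f y) - (f x - f x')); last by ring.
  by apply: le_lt_trans (ler_normB _ _) _; lra.
move=> d /= d0 H.
have d20 : 0 < d / 2 by lra.
exists (d / 2) => // s t s01 _ st.
apply: (H (d / 2) _ _ s _ t) => //=.
by rewrite sub0r normrN gtr0_norm//; lra.
Unshelve. all: by end_near. Qed.

(* The slope (X s - X t) / (s - t) of the antiderivative X of f, in a form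
   that makes sense and varies continuously across the diagonal. *)
Definition slope f s t : R := antideriv (fun x => f (t + x * (s - t))) 1.

Lemma continuous_chord f s t : continuous f ->
  continuous (fun x : R => f (t + x * (s - t))).
Proof.
move=> cf x; apply: (@continuous_comp R R R (fun x : R => t + x * (s - t)) f).
  apply: (@continuousD _ _ _ (cst t) (fun x : R => x * (s - t))).
    exact: cst_continuous.
  by apply: continuousM; [exact: cvg_id|exact: cst_continuous].
exact: cf.
Qed.

(** Affine change of variables: [F] and [G] have the same derivative on [0, 1], hence the same
    increment, and this covers s = t as well. *)
Lemma slopeE f s t : continuous f -> 0 <= s <= 1 -> 0 <= t <= 1 ->
  slope f s t * (s - t) = antideriv f s - antideriv f t.
Proof.
move=> cf s01 t01.
pose F : R -> R := antideriv f \o (fun x => t + x * (s - t)).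
pose G : R -> R := (s - t) *: antideriv (fun x : R => f (t + x * (s - t))).
have in01 (x : R) : 0 <= x <= 1 -> 0 <= t + x * (s - t) <= 1.
  by move=> x01; apply/andP; split; nra.
have dF (x : R) : 0 <= x <= 1 -> is_derive x 1 F (f (t + x * (s - t)) * (s - t)).
  move=> /in01 x01.
  have H : is_derive x 1 (fun x => t + x * (s - t)) (s - t).
    have := is_deriveD (is_derive_cst t x 1)
      (is_deriveM (is_derive_id x 1) (is_derive_cst (s - t) x 1)).
    by move=> H; apply: is_derive_eq; rewrite /GRing.scale/=; ring.
  apply: is_derive1_comp => //; apply: is_derive_antideriv => //; lra.
have dG (x : R) : 0 <= x <= 1 -> is_derive x 1 G (f (t + x * (s - t)) * (s - t)).
  move=> x01; rewrite mulrC; have x1 : -1 < x by lra.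
  have H := is_derive_antideriv (@continuous_chord f s t cf) x1.
  by have := is_deriveZ (s - t) H.
have cont (H : R -> R) :
    (forall x : R, 0 <= x <= 1 -> is_derive x 1 H (f (t + x * (s - t)) * (s - t))) ->
    {within `[0, 1], continuous H}.
  move=> dH; apply: continuous_in_subspaceT => x; rewrite inE/= in_itv/=.
  by move=> /dH; exact: is_derive_continuous.
have [FG GF] : F 1 - F 0 <= G 1 - G 0 /\ G 1 - G 0 <= F 1 - F 0.
  have dF' (x : R) : x \in `]0, 1[ -> is_derive x 1 F (f (t + x * (s - t)) * (s - t)).
    by rewrite in_itv/= => x01; apply: dF; lra.
  have dG' (x : R) : x \in `]0, 1[ -> is_derive x 1 G (f (t + x * (s - t)) * (s - t)).
    by rewrite in_itv/= => x01; apply: dG; lra.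
  by split; [apply: (le_increment ler01 dF' dG')|apply: (le_increment ler01 dG' dF')];
    rewrite //; exact: cont.
have E : F 1 - F 0 = G 1 - G 0 by apply/eqP; rewrite eq_le FG GF.
move: E; rewrite /F /G /slope !fctE /= antideriv0 mul1r mul0r addr0 subrKC.
by rewrite scaler0 subr0 /GRing.scale/= mulrC => ->.
Qed.

Lemma slope_mvt f s t : continuous f -> 0 <= s <= 1 -> 0 <= t <= 1 ->
  exists2 c, 0 <= c <= 1 & slope f s t = f c.
Proof.
move=> cf s01 t01.
have [c c01] := antideriv_mvt (@continuous_chord f s t cf) (lexx 0) ler01.
rewrite antideriv0 !subr0 mulr1 => ?; exists (t + c * (s - t)) => //.
by apply/andP; split; nra.
Qed.

Lemma slope_diag f t : continuous f -> slope f t t = f t.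
Proof.
move=> cf; rewrite /slope subrr.
under [X in antideriv X]eq_fun do rewrite mulr0 addr0.
by rewrite antideriv_cst// mulr1.
Qed.

Lemma slope_dist f g e s t : continuous f -> continuous g ->
  0 <= s <= 1 -> 0 <= t <= 1 ->
  (forall x, 0 <= x <= 1 -> `|f x - g x| <= e) ->
  `|slope f s t - slope g s t| <= e.
Proof.
move=> cf cg s01 t01 fg; apply: antideriv_dist; try exact: continuous_chord.
  by rewrite ler01 lexx.
by move=> x x01; apply: fg; apply/andP; split; nra.
Qed.

Lemma slope_uniform_continuity f e : continuous f -> 0 < e ->
  exists2 d, 0 < d & forall s t s' t', 0 <= s <= 1 -> 0 <= t <= 1 ->
    0 <= s' <= 1 -> 0 <= t' <= 1 -> `|s - s'| < d -> `|t - t'| < d ->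
    `|slope f s t - slope f s' t'| <= e.
Proof.
move=> cf /(itv01_uniform_continuity cf)[d d0 fd].
exists (d / 2); first by lra.
move=> s t s' t' s01 t01 s'01 t'01 ss' tt'.
apply: antideriv_dist; try exact: continuous_chord.
  by rewrite ler01 lexx.
(* The points at parameter x of the two chords differ by (1 - x)(t - t') + x (s - s'), a convex
   combination of the two displacements. *)
move=> x /andP[x0 x1]; apply/ltW/fd.
- by apply/andP; split; nra.
- by apply/andP; split; nra.
move: ss' tt'; rewrite !ltr_norml => /andP[? ?] /andP[? ?].
by apply/andP; split; nra.
Qed.

End slopes.

(** * Total variation of a function that drops across every point *)

Section total_rise.
Variable R : realType.

(** Real induction. Around [sup A] the step carries [J] from a point of [A] to [sup A + d / 2],
    against the choice of the supremum, unless 1 is already within reach. *)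
Lemma itv01_induction (J : R -> Prop) : J 0 ->
  (forall t, 0 <= t <= 1 -> exists2 d, 0 < d & forall u v, 0 <= u -> u <= v ->
     v <= 1 -> `|t - u| < d -> `|t - v| < d -> J u -> J v) ->
  J 1.
Proof.
move=> J0 step; pose A := [set t | 0 <= t <= 1 /\ J t].
have supA : has_sup A.
  by split; [exists 0; split; rewrite ?lexx ?ler01|exists 1 => t [/andP[]]].
have s0 : 0 <= sup A by apply: (ub_le_sup supA.2); split; rewrite ?lexx ?ler01.
have s1 : sup A <= 1 by apply: (ge_sup supA.1) => t [/andP[]].
have [|d d0 H] := step (sup A); first by rewrite s0.
have [u [/andP[u0 u1] Ju] us] := sup_adherent d0 supA.
have uA : u <= sup A by apply: (ub_le_sup supA.2); split => //; rewrite u0.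
have ud : `|sup A - u| < d by rewrite ger0_norm; lra.
have [ds|ds] := leP (sup A + d / 2) 1.
  have : J (sup A + d / 2).
    by apply: (H u) => //; [lra|rewrite opprD addNKr normrN gtr0_norm; lra].
  move=> Jd; suff : sup A + d / 2 <= sup A by lra.
  by apply: (ub_le_sup supA.2); split => //; apply/andP; split; lra.
by apply: (H u) => //; rewrite ler0_norm; lra.
Qed.

(* [J t] says that the minimum of Y over [t, 1] plus its maximum over [0, t]
   is at most P t.  At a record high t of Y the minimum is attained strictly
   later, so it stays constant near t while the maximum grows no faster than
   P; at any other t the maximum is constant near t, and the minimum grows no
   faster than P. *)
Lemma twice_rise_le (Y P : R -> R) :
  (forall t, 0 <= t <= 1 -> {for t, continuous Y}) ->
  (forall a b, 0 <= a -> a <= b -> b <= 1 -> Y b - Y a <= P b - P a) ->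
  (forall a b, 0 <= a -> a <= b -> b <= 1 -> P a <= P b) ->
  (forall t, 0 <= t <= 1 -> exists a b, [/\ 0 <= a, a <= t, t <= b, b <= 1 & Y b < Y a]) ->
  Y 0 = 0 -> P 0 = 0 -> 2 * Y 1 <= P 1.
Proof.
move=> cY YP Pm cov Y0 P0.
pose J (t : R) := forall c : R, 0 <= c -> c <= t ->
  exists b, [/\ t <= b, b <= 1 & Y b + Y c <= P t].
suff J1 : J 1.
  have [b [b1 b2]] := J1 1 ler01 (lexx _).
  have eb : b = 1 by lra.
  by rewrite eb; lra.
apply: itv01_induction => [c c0 c1|t t01].
  have -> : c = 0 by lra.
  by exists 0; split => //; rewrite Y0 P0 addr0.
have near_lt (k : R) : Y t < k ->
    exists2 d, 0 < d & forall u, `|t - u| < d -> Y u < k.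
  move=> tk; have k0 : 0 < k - Y t by lra.
  have /cvgrPdist_lt/(_ _ k0)[/= d d0 H] := cY t t01.
  by exists d => // u /H; rewrite ltr_norml => /andP[]; lra.
have near_gt (k : R) : k < Y t ->
    exists2 d, 0 < d & forall u, `|t - u| < d -> k < Y u.
  move=> tk; have k0 : 0 < Y t - k by lra.
  have /cvgrPdist_lt/(_ _ k0)[/= d d0 H] := cY t t01.
  by exists d => // u /H; rewrite ltr_norml => /andP[]; lra.
(* Either some earlier value exceeds [Y t], and then [c0] can stand in for any [c] between [u] and
   [v], or [t] is a record high. *)
have [[c0 [c00 c0t Yc0]]|nrec] :=
  pselect (exists c0, [/\ 0 <= c0, c0 <= t & Y t < Y c0]).
  have c0t' : c0 < t.
    by rewrite lt_neqAle c0t andbT; apply: contraTneq Yc0 => ->; rewrite ltxx.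
  have [d d0 Hd] := near_lt _ Yc0.
  exists (Num.min d (t - c0)); first by rewrite lt_min d0/=; lra.
  move=> u v u0 uv v1; rewrite !lt_min => /andP[ud uc] /andP[vd vc] Ju c cge cv.
  have cu : c0 <= u by move: uc; rewrite ltr_norml => /andP[]; lra.
  have [c' [c'0 c'u Yc']] : exists c', [/\ 0 <= c', c' <= u & Y c <= Y c'].
    have [cu'|uc'] := leP c u; first by exists c.
    exists c0; split => //; apply/ltW/Hd.
    move: ud vd; rewrite !ltr_norml => /andP[? ?] /andP[? ?].
    by apply/andP; split; lra.
  have [b [ub b1 Yb]] := Ju c' c'0 c'u.
  have [vb|bv] := leP v b.
    by exists b; split => //; have := Pm u v u0 uv v1; lra.
  exists v; split => //.
  have := YP b v (le_trans u0 ub) (ltW bv) v1.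
  by have := Pm u b u0 ub b1; lra.
have rec c : 0 <= c -> c <= t -> Y c <= Y t.
  by move=> c0 ct; rewrite leNgt; apply/negP => H; apply: nrec; exists c.
have [a [b0 [a0 at_ tb b01 Yab]]] := cov t t01.
have Yb0 : Y b0 < Y t by apply: (lt_le_trans Yab); exact: rec.
have tb' : t < b0.
  by rewrite lt_neqAle tb andbT; apply: contraTneq Yb0 => <-; rewrite ltxx.
have [d d0 Hd] := near_gt _ Yb0.
exists (Num.min d (b0 - t)); first by rewrite lt_min d0/=; lra.
move=> u v u0 uv v1; rewrite !lt_min => /andP[ud _] /andP[vd vb0] Ju c cge cv.
have vb : v <= b0 by move: vb0; rewrite ltr_norml => /andP[]; lra.
(* A point [b] before [v] can be replaced by [b0], which lies beyond [v] and where [Y] is smaller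
   than at every point near [t]. *)
have {}Ju c' : 0 <= c' -> c' <= u -> exists b, [/\ v <= b, b <= 1 & Y b + Y c' <= P u].
  move=> c'0 c'u; have [b [ub b1 Yb]] := Ju c' c'0 c'u.
  have [vb'|bv] := leP v b; first by exists b.
  exists b0; split => //; suff : Y b0 < Y b by lra.
  apply: Hd; move: ud vd; rewrite !ltr_norml => /andP[? ?] /andP[? ?].
  by apply/andP; split; lra.
have [cu|uc] := leP c u.
  have [b [vb' b1 Yb]] := Ju c cge cu; exists b; split => //.
  by have := Pm u v u0 uv v1; lra.
have [b [vb' b1 Yb]] := Ju u u0 (lexx u); exists b; split => //.
have := YP u c u0 (ltW uc) (le_trans cv v1).
by have := Pm c v cge cv v1; lra.
Qed.

Lemma continuous_pos (h : R -> R) : continuous h ->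
  continuous (fun x => Num.max 0 (h x)).
Proof.
move=> ch x; apply: (@continuous_max _ _ (cst 0) h); first exact: cst_continuous.
exact: ch.
Qed.

Lemma continuous_normf (h : R -> R) : continuous h -> continuous (fun x => `|h x|).
Proof. by move=> ch x; apply: (continuous_comp (ch x)); exact: norm_continuous. Qed.

(** With [P] the primitive of the positive part, [twice_rise_le] bounds the positive variation from
    below; then |h| = 2 max(0, h) - h turns the factor 2 into 2 * 2 - 1 = 3. *)
Lemma thrice_rise_le (h : R -> R) : continuous h ->
  (forall t, 0 <= t <= 1 -> exists a b,
    [/\ 0 <= a, a <= t, t <= b, b <= 1 & antideriv h b < antideriv h a]) ->
  3 * antideriv h 1 <= antideriv (fun x => `|h x|) 1.
Proof.
move=> ch cov; have cp := continuous_pos ch; have ca := continuous_normf ch.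
have : 2 * antideriv h 1 <= antideriv (fun x => Num.max 0 (h x)) 1.
  apply: (twice_rise_le (Y := antideriv h)) => //; last 2 first.
  - exact: antideriv0.
  - exact: antideriv0.
  - by move=> t t01; apply: continuous_antideriv => //; lra.
  - move=> a b a0 ab _; apply: le_antideriv => // x _.
    by rewrite le_max lexx orbT.
  - move=> a b a0 ab _; apply: antideriv_nondecreasing => // x _.
    by rewrite le_max lexx.
suff -> : antideriv (fun x => `|h x|) 1 =
    2 * antideriv (fun x => Num.max 0 (h x)) 1 + (-1) * antideriv h 1 by lra.
rewrite -antideriv_lin ?ler01//; congr (antideriv _ 1); apply/funext => x.
by case: (lerP 0 (h x)) => hx; [rewrite ger0_norm//|rewrite ltr0_norm//]; ring.
Qed.

End total_rise.

(** * The gauge and its primitive *)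

Section gauge.
Variable R : realType.
Implicit Types (f g : R -> R) (a b d e s t : R).

Lemma itv01_not_isolated d t : 0 < d -> 0 <= t <= 1 ->
  exists2 s, 0 <= s <= 1 & s != t /\ `|t - s| < d.
Proof.
(* A step of length at most 1/2 towards the farther endpoint stays in [0, 1]. *)
move=> d0 /andP[t0 t1]; pose m := Num.min (d / 2) (1 / 2).
have m0 : 0 < m by rewrite lt_min; apply/andP; split; lra.
have m1 : m <= 1 / 2 by rewrite ge_min lexx orbT.
have md : m <= d / 2 by rewrite ge_min lexx.
clearbody m; have [t12|t12] := leP t (1 / 2).
  exists (t + m); first by apply/andP; split; lra.
  split; first by apply/eqP => E; lra.
  by rewrite ltr_norml; apply/andP; split; lra.
exists (t - m); first by apply/andP; split; lra.
split; first by apply/eqP => E; lra.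
by rewrite ltr_norml; apply/andP; split; lra.
Qed.

(** The nearest-point retraction onto [0, 1]. Composing with it extends functions on [0, 1]
    continuously to the whole line, where [antideriv] operates. *)
Definition clamp t : R := Num.max 0 (Num.min t 1).

Lemma clamp_itv01 t : 0 <= clamp t <= 1.
Proof. by rewrite /clamp le_max lexx ge_max ler01 ge_min lexx orbT. Qed.

Lemma clamp_id t : 0 <= t <= 1 -> clamp t = t.
Proof. by move=> /andP[t0 t1]; rewrite /clamp (min_idPl t1) (max_idPr t0). Qed.

Lemma max0_dist a b : `|Num.max 0 a - Num.max 0 b| <= `|a - b|.
Proof.
case: (leP 0 a) => a0; case: (leP 0 b) => b0; rewrite ?subrr ?normr0 ?normr_ge0// ler_norml;
  case: (lerP b a) => ab; apply/andP; split; lra.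
Qed.

Lemma clamp_dist s t : `|clamp s - clamp t| <= `|s - t|.
Proof.
apply: (le_trans (max0_dist _ _)).
case: (leP s 1) => s1; case: (leP t 1) => t1; rewrite ?subrr ?normr0 ?normr_ge0//;
  rewrite ler_norml; case: (lerP t s) => st; apply/andP; split; lra.
Qed.

Definition minslope f t : R := inf [set slope f s t | s in `[0, 1]].

(** Every slope is a value of f on [0, 1], so the minimum of f is a lower bound. *)
Lemma has_inf_slope f t : continuous f -> 0 <= t <= 1 ->
  has_inf [set slope f s t | s in `[0, 1]].
Proof.
move=> cf t01; split; first by exists (slope f 0 t), 0; rewrite //= in_itv/= lexx ler01.
have [c _ fc] := EVT_min ler01 (continuous_subspaceT cf).
exists (f c) => _ [s /= s01 <-].
move: s01; rewrite in_itv/= => s01; have [c' c'01 ->] := slope_mvt cf s01 t01.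
by apply: fc; rewrite in_itv.
Qed.

Lemma minslope_le f s t : continuous f -> 0 <= s <= 1 -> 0 <= t <= 1 ->
  minslope f t <= slope f s t.
Proof.
move=> cf s01 t01; apply: (ge_inf (has_inf_slope cf t01).2).
by exists s; rewrite //= in_itv.
Qed.

Lemma minslope_lt f t e : continuous f -> 0 <= t <= 1 -> minslope f t < e ->
  exists2 s, 0 <= s <= 1 & slope f s t < e.
Proof.
move=> cf t01 H; have [|_ [s /= s01 <-] se] :=
  inf_adherent (_ : 0 < e - minslope f t) (has_inf_slope cf t01).
  by rewrite subr_gt0.
by exists s; [move: s01; rewrite in_itv|move: se; rewrite subrKC].
Qed.

(** Infima of e-close families are e-close. Allowing two functions and two base points gives both
    the dependence on the rope and the continuity in t. *)
Lemma minslope_dist f g e t t' : continuous f -> continuous g ->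
  0 <= t <= 1 -> 0 <= t' <= 1 ->
  (forall s, 0 <= s <= 1 -> `|slope f s t - slope g s t'| <= e) ->
  `|minslope f t - minslope g t'| <= e.
Proof.
move=> cf cg t01 t'01 fg; rewrite ler_norml; apply/andP; split.
  rewrite lerNl opprB; apply/ler_addgt0Pr => k k0.
  have [|s s01 sk] := minslope_lt (e := minslope f t + k) cf t01; first by lra.
  have := minslope_le cg s01 t'01.
  by have := fg s s01; rewrite ler_norml => /andP[]; lra.
apply/ler_addgt0Pr => k k0.
have [|s s01 sk] := minslope_lt (e := minslope g t' + k) cg t'01; first by lra.
have := minslope_le cf s01 t01.
by have := fg s s01; rewrite ler_norml => /andP[]; lra.
Qed.

Definition gauge f t : R := Num.max 0 (minslope f (clamp t)).

Lemma gauge_ge0 f t : 0 <= gauge f t.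
Proof. by rewrite /gauge le_max lexx. Qed.

Lemma gauge_le_slope f s t : continuous f -> 0 <= s <= 1 -> 0 <= t <= 1 ->
  0 < gauge f t -> gauge f t <= slope f s t.
Proof.
move=> cf s01 t01; rewrite /gauge clamp_id//.
case: (leP 0 (minslope f t)) => [_ _|_]; last by rewrite ltxx.
exact: minslope_le.
Qed.

Lemma gauge_dist f g e t : continuous f -> continuous g ->
  (forall x, 0 <= x <= 1 -> `|f x - g x| <= e) -> `|gauge f t - gauge g t| <= e.
Proof.
move=> cf cg fg; apply: (le_trans (max0_dist _ _)).
apply: minslope_dist; rewrite ?clamp_itv01// => s s01.
by apply: slope_dist => //; exact: clamp_itv01.
Qed.

Lemma continuous_gauge f : continuous f -> continuous (gauge f).
Proof.
move=> cf t; apply/cvgrPdist_le => /= e e0.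
have [d d0 H] := slope_uniform_continuity cf e0.
exists d => // s /= ts; apply: (le_trans (max0_dist _ _)).
apply: minslope_dist; rewrite ?clamp_itv01// => u u01.
apply: H; rewrite ?clamp_itv01 ?subrr ?normr0//.
exact: le_lt_trans (clamp_dist _ _) ts.
Qed.

(** Some [c] between a and b has positive gauge. All slopes at [c] are at least [gauge f c], so the
    rises of the primitive of f from a to c and from c to b add up to at least
    [gauge f c * (b - a)]. *)
Lemma gauge_increasing f a b : continuous f -> 0 <= a -> a <= b -> b <= 1 ->
  antideriv (gauge f) a < antideriv (gauge f) b -> antideriv f a < antideriv f b.
Proof.
move=> cf a0 ab b1 G.
have [c /andP[ac cb] E] := antideriv_mvt (continuous_gauge cf) a0 ab.
have gab : 0 < gauge f c * (b - a) by rewrite -E subr_gt0.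
have gc : 0 < gauge f c.
  rewrite lt_neqAle gauge_ge0 andbT eq_sym.
  by apply: contraTneq gab => ->; rewrite mul0r ltxx.
have c01 : 0 <= c <= 1 by apply/andP; split; lra.
have a01 : 0 <= a <= 1 by apply/andP; split; lra.
have b01 : 0 <= b <= 1 by apply/andP; split; lra.
have Ha := slopeE cf a01 c01; have Hb := slopeE cf b01 c01.
have Sa := gauge_le_slope cf a01 c01 gc; have Sb := gauge_le_slope cf b01 c01 gc.
nra.
Qed.

Lemma antideriv_gauge_gt0 f : continuous f ->
  antideriv (fun x => `|f x|) 1 < 3 * antideriv f 1 ->
  0 < antideriv (gauge f) 1.
Proof.
move=> cf L; have cg := continuous_gauge cf.
rewrite ltNge; apply/negP => G0.
have gauge0 t : 0 <= t <= 1 -> gauge f t <= 0.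
  move=> /andP[t0 t1]; rewrite leNgt; apply/negP => gt.
  have /cvgrPdist_lt/(_ _ gt)[/= d d0 H] := cg t.
  (* On this nondegenerate interval around t the gauge is positive by continuity, so its integral
     over [0, 1] would be positive. *)
  pose a := Num.max 0 (t - d / 2); pose b := Num.min 1 (t + d / 2).
  have /andP[a0 at_] : 0 <= a <= t by rewrite /a le_max lexx ge_max t0/=; lra.
  have /andP[tb b1] : t <= b <= 1 by rewrite /b le_min ge_min t1 lexx/= andbT; lra.
  have ab : a < b.
    by rewrite /a /b gt_max !lt_min; apply/andP; split; apply/andP; split; lra.
  have da : t - d / 2 <= a by rewrite /a le_max lexx orbT.
  have db : b <= t + d / 2 by rewrite /b ge_min lexx orbT.
  clearbody a b; have [c /andP[ac cb] E] := antideriv_mvt cg a0 (ltW ab).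
  have : 0 < gauge f c.
    have : `|gauge f t - gauge f c| < gauge f t.
      by apply: H => /=; rewrite ltr_norml; apply/andP; split; lra.
    by rewrite ltr_norml => /andP[]; lra.
  move=> gc; have : 0 < gauge f c * (b - a) by rewrite mulr_gt0 ?subr_gt0.
  rewrite -E.
  have := antideriv_nondecreasing cg (lexx 0) a0 (fun x _ => gauge_ge0 f x).
  have b0 : 0 <= b by lra.
  have := antideriv_nondecreasing cg b0 b1 (fun x _ => gauge_ge0 f x).
  by rewrite antideriv0; lra.
(* Replacing f by f - e costs at most 3 e on one side and e on the other, in all 4 e, which is half
   of the gap. *)
pose e := (3 * antideriv f 1 - antideriv (fun x => `|f x|) 1) / 8.
have e0 : 0 < e by rewrite /e; lra.
pose h x := 1 * f x + (- e) * 1.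
have ch : continuous h by apply: continuous_lin => // x; exact: cst_continuous.
have hE t : 0 <= t -> antideriv h t = antideriv f t - e * t.
  move=> t0; rewrite [LHS]antideriv_lin//; last by move=> x; exact: cst_continuous.
  by rewrite (antideriv_cst 1 t0); ring.
have : 3 * antideriv h 1 <= antideriv (fun x => `|h x|) 1.
  apply: thrice_rise_le => // t t01.
  have : minslope f t < e.
    apply: le_lt_trans e0; move: (gauge0 t t01); rewrite /gauge clamp_id//.
    by rewrite ge_max => /andP[].
  move=> /(minslope_lt cf t01)[s0 s001 s0e].
  (* A slope below e at s = t, that is f t < e, yields no pair of points; continuity of the slope
     moves s off t. *)
  have [s [s01 st se]] : exists s, [/\ 0 <= s <= 1, s != t & slope f s t < e].
    have [s0t|] := eqVneq s0 t; last by exists s0.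
    have k0 : 0 < (e - slope f s0 t) / 2 by lra.
    have [d d0 H] := slope_uniform_continuity cf k0.
    have [s s01 [st ts]] := itv01_not_isolated d0 t01.
    exists s; split => //.
    have : `|slope f s0 t - slope f s t| <= (e - slope f s0 t) / 2.
      by apply: H => //; rewrite ?subrr ?normr0// s0t.
    by rewrite ler_norml => /andP[]; lra.
  have := slopeE cf s01 t01.
  case/andP: (s01) => ? ?; case/andP: (t01) => ? ?.
  have [ts|] := ltP t s => [E|st' E].
    exists t, s; split => //; first exact: ltW.
    by rewrite !hE//; nra.
  have {}st : s < t by rewrite lt_neqAle st.
  by exists s, t; split => //; rewrite !hE//; nra.
have ca := continuous_normf cf; have cha := continuous_normf ch.
have : `|antideriv (fun x => `|h x|) 1 - antideriv (fun x => `|f x|) 1| <= e.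
  apply: antideriv_dist => //; first by rewrite ler01 lexx.
  move=> x _; apply: (le_trans (ler_dist_dist _ _)).
  rewrite (_ : h x - f x = - e); last by rewrite /h; ring.
  by rewrite normrN gtr0_norm.
by rewrite hE// ler_norml => /andP[]; rewrite /e; lra.
Qed.

End gauge.

(** * Topology and differentiation on [0, 1] *)

Section unit_interval.
Variable R : realType.
Notation I := (I01 R).

Lemma I01_itv (t : I) : 0 <= val t <= 1.
Proof. by have := set_valP t; rewrite /= in_itv. Qed.

Lemma nbhs_I01P (t : I) (U : set I) :
  nbhs t U <-> exists2 d, 0 < d & forall s : I, `|val t - val s| < d -> U s.
Proof.
by rewrite nbhs_ballP; split=> -[d d0 H]; exists d.
Qed.

(** Makes limits along [t^'] unique, so that [deriv01] can be computed by [cvg_lim]. *)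
Lemma dnbhs_I01_proper (t : I) : ProperFilter t^'.
Proof.
apply: Build_ProperFilter_ex => P; rewrite /dnbhs /within/=.
move=> /nbhs_I01P[d d0 H].
have [x x01 [xt tx]] := itv01_not_isolated d0 (I01_itv t).
have xI : x \in (`[0, 1]%classic : set R) by rewrite inE/= in_itv.
by exists (exist _ x xI); apply: H.
Qed.

Lemma clampI_subproof (x : R) : clamp x \in (`[0, 1]%classic : set R).
Proof. by rewrite inE/= in_itv/= clamp_itv01. Qed.

Definition clampI (x : R) : I := exist _ (clamp x) (clampI_subproof x).

Lemma clampIK (t : I) : clampI (val t) = t.
Proof. by apply: val_inj; rewrite /= clamp_id ?I01_itv. Qed.

Lemma val_clampI (x : R) : 0 <= x <= 1 -> val (clampI x) = x.
Proof. exact: clamp_id. Qed.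

Lemma continuous_clampI : continuous clampI.
Proof.
move=> x U /nbhs_I01P[d d0 H]; apply/nbhs_ballP; exists d => // y xy.
apply: H; exact: le_lt_trans (clamp_dist _ _) xy.
Qed.

Lemma continuous_valI : continuous (val : I -> R).
Proof. exact: initial_continuous. Qed.

Lemma compact_I01 : compact [set: I].
Proof.
have -> : [set: I] = clampI @` `[0, 1].
  apply/seteqP; split => // t _; exists (val t); first exact: set_valP.
  exact: clampIK.
apply: continuous_compact; last exact: segment_compact.
by apply: continuous_subspaceT; exact: continuous_clampI.
Qed.

(** A continuous map from a compact space to a Hausdorff space is closed, so the complement of the
    image of [~] U is open; injectivity makes U its preimage. *)
Lemma injective_I01_embedding (V : topologicalType) (r : I -> V) :
  hausdorff_space V -> continuous r -> injective r -> topological_embedding r.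
Proof.
move=> hV cr ir; split=> // U; split=> [oU|[W oW <-]]; last first.
  by move/continuousP : cr; exact.
exists (~` (r @` (~` U))).
  apply: closed_openC; apply: compact_closed => //.
  apply: (@continuous_compact _ _ r).
    exact: continuous_subspaceT.
  apply: (subclosed_compact _ compact_I01) => //.
  exact: open_closedC.
apply/seteqP; split=> [t /= H|t Ut /= [s nUs /ir ts]].
  by apply: contrapT => nUt; apply: H; exists t.
by apply: nUs; rewrite ts.
Qed.

Lemma topological_embedding_continuous (X Y : topologicalType) (r : X -> Y) :
  topological_embedding r -> continuous r.
Proof. by move=> [_ H]; apply/continuousP => W oW; apply/H; exists W. Qed.

(** Off the diagonal the quotient is [slope f], which is continuous up to the diagonal; endpoints
    and interior points are treated alike. *)
Lemma cvg_antideriv_quotient (f : R -> R) (t : I) : continuous f ->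
  (val s - val t)^-1 * (antideriv f (val s) - antideriv f (val t)) @[s --> t^']
    --> f (val t).
Proof.
move=> cf; have FF := dnbhs_I01_proper t.
apply/cvgrPdist_le => /= e e0.
have [d d0 H] := slope_uniform_continuity cf e0.
apply/nbhs_I01P; exists d => // s ts st.
have st0 : val s - val t != 0.
  by rewrite subr_eq0; apply: contra st => /eqP/val_inj/eqP.
rewrite -slopeE ?I01_itv// mulrC mulfK//.
by rewrite -[f _]slope_diag//; apply: H; rewrite ?I01_itv// subrr normr0.
Qed.

(* Only interior points matter, so the one-sided derivatives of h at the
   endpoints play no role. *)
Lemma antideriv_of_quotient (h : I -> R) (f : R -> R) : continuous f ->
  continuous h ->
  (forall t : I, (val s - val t)^-1 * (h s - h t) @[s --> t^'] --> f (val t)) ->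
  forall t : I, h t - h (I01_0 R) = antideriv f (val t).
Proof.
move=> cf ch dh t.
have cH : continuous (h \o clampI).
  by move=> x; apply: continuous_comp; [exact: continuous_clampI|exact: ch].
have dH (x : R) : x \in `]0, val t[ -> is_derive x 1 (h \o clampI) (f x).
  rewrite in_itv/= => /andP[x0 xt]; have /andP[_ t1] := I01_itv t.
  have x01 : 0 <= x <= 1 by apply/andP; split; apply/ltW => //; exact: lt_le_trans t1.
  have vx : val (clampI x) = x by rewrite val_clampI.
  have cx : (fun y : R => y^-1 *: ((h \o clampI) (y *: 1 + x) - (h \o clampI) x)) @ 0^'
      --> f x.
    apply/cvgrPdist_lt => e e0.
    have := dh (clampI x); rewrite vx => /cvgrPdist_lt/(_ _ e0).
    move=> /nbhs_I01P[d d0 H].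
    (* Closer to x than both endpoints, clamping is the identity, so the two-sided quotient is the
       quotient taken in [0, 1]. *)
    have m0 : 0 < Num.min d (Num.min x (1 - x)).
      rewrite !lt_min d0 x0/= subr_gt0; exact: lt_le_trans t1.
    exists (Num.min d (Num.min x (1 - x))) => // y /=.
    rewrite sub0r normrN !lt_min => /and3P[yd yx y1] y0.
    have yx01 : 0 <= y *: 1 + x <= 1.
      rewrite /GRing.scale/= mulr1; move: yx y1; rewrite !ltr_norml => /andP[? ?] /andP[? ?].
      by apply/andP; split; lra.
    have /H : `|val (clampI x) - val (clampI (y *: 1 + x))| < d.
      by rewrite vx val_clampI// /GRing.scale/= mulr1 opprD addrCA subrr addr0 normrN.
    rewrite val_clampI// /GRing.scale/= mulr1 addrK; apply.
    apply/eqP => /(congr1 val); move: yx01; rewrite /GRing.scale/= mulr1 => yx01.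
    by rewrite !clamp_id// => E; move/eqP: y0; apply; lra.
  split; first by apply/cvg_ex; exists (f x).
  exact: cvg_lim cx.
have t0 : 0 <= val t by have /andP[] := I01_itv t.
have dA (x : R) : x \in `]0, val t[ -> is_derive x 1 (antideriv f) (f x).
  by rewrite in_itv/= => /andP[x0 _]; apply: is_derive_antideriv => //; lra.
have wH : {within `[0, val t], continuous (h \o clampI)} by exact: continuous_subspaceT.
have wA : {within `[0, val t], continuous (antideriv f)}.
  by apply: within_continuous_antideriv => //; lra.
have := le_increment t0 dH dA wH wA (fun _ _ => lexx _).
have := le_increment t0 dA dH wA wH (fun _ _ => lexx _).
rewrite /= antideriv0 subr0 clampIK.
have -> : clampI 0 = I01_0 R by rewrite -[0]/(val (I01_0 R)) clampIK.
by move=> H1 H2; apply/eqP; rewrite eq_le H1 H2.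
Qed.

End unit_interval.

(** * Tightening a single rope *)

Section tightening.
Variable R : realType.
Notation I := (I01 R).
Notation V := 'rV[R]_3.
Implicit Types (r : I -> V) (s : R).

Lemma enormE (v : V) :
  enorm v = Num.sqrt (v 0 0 ^+ 2 + (v 0 1 ^+ 2 + v 0 (lift 0 1) ^+ 2)).
Proof.
by rewrite /enorm !big_ord_recl big_ord0 addr0; do 3 (congr (_ + _) || congr Num.sqrt);
  congr (v _ _ ^+ _); apply: val_inj.
Qed.

Lemma continuous_enorm : continuous (@enorm R).
Proof.
have -> : @enorm R = fun v => Num.sqrt (v 0 0 ^+ 2 + (v 0 1 ^+ 2 + v 0 (lift 0 1) ^+ 2)).
  by apply/funext => v; exact: enormE.
have cc (j : 'I_3) (v : V) : {for v, continuous (fun v : V => v 0 j ^+ 2)}.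
  apply: (@continuous_comp _ _ _ (fun v : V => v 0 j) (fun x : R => x ^+ 2)).
    exact: coord_continuous.
  exact: exprn_continuous.
move=> v; apply: (@continuous_comp _ _ _ (fun v : V => v 0 0 ^+ 2 +
  (v 0 1 ^+ 2 + v 0 (lift 0 1) ^+ 2)) Num.sqrt); last exact: sqrt_continuous.
exact: (cvgD (cc 0 v) (cvgD (cc 1 v) (cc (lift 0 1) v))).
Qed.

Lemma normr_coord0_le_enorm (v : V) : `|v 0 0| <= enorm v.
Proof.
by rewrite enormE -sqrtr_sqr ler_wsqrtr// lerDl addr_ge0 ?sqr_ge0.
Qed.

(** The Euclidean triangle inequality with one vector along the first axis: after squaring, it
    reduces to [v 0 0 <= enorm v]. *)
Lemma enormDB_le (k l : R) (v : V) : 0 <= k -> 0 <= l ->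
  enorm (k *: v + l *: pointB R) <= k * enorm v + l.
Proof.
move=> k0 l0; have n0 : 0 <= enorm v by exact: sqrtr_ge0.
have vn := normr_coord0_le_enorm v.
have r0 : 0 <= k * enorm v + l by rewrite addr_ge0 ?mulr_ge0.
rewrite -[leRHS]ger0_norm// -sqrtr_sqr [leLHS]enormE ler_wsqrtr//.
have := sqr_sqrtr (_ : 0 <= v 0 0 ^+ 2 + (v 0 1 ^+ 2 + v 0 (lift 0 1) ^+ 2)).
rewrite -enormE => /(_ _)-E.
rewrite !mxE/= !mulr1 !mulr0 !addr0.
have {}E : enorm v ^+ 2 = v 0 0 ^+ 2 + (v 0 1 ^+ 2 + v 0 (lift 0 1) ^+ 2).
  by apply: E; rewrite !addr_ge0 ?sqr_ge0.
have : v 0 0 <= enorm v by exact: le_trans (ler_norm _) vn.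
move: E; set x := v 0 0; set y := v 0 1; set z := v 0 (lift 0 1) => E xn.
have kl : 0 <= k * l by exact: mulr_ge0.
have : k * l * x <= k * l * enorm v by exact: ler_wpM2l.
by rewrite (_ : (k * x + l) ^+ 2 + _ = k ^+ 2 * (enorm v ^+ 2) + 2 * (k * l * x) + l ^+ 2);
  [nra|rewrite E; ring].
Qed.

(** Constant on either side of [0, 1], hence continuous on the line for a C^1 curve. *)
Definition velocity r (j : 'I_3) (x : R) : R := deriv01 r (clampI x) 0 j.

Lemma velocity_val r j (t : I) : velocity r j (val t) = deriv01 r t 0 j.
Proof. by rewrite /velocity clampIK. Qed.

Lemma continuous_velocity r j : is_C1 r -> continuous (velocity r j).
Proof.
move=> [_ cr] x.
apply: (@continuous_comp _ _ _ (@clampI R) (fun t => deriv01 r t 0 j)).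
  exact: continuous_clampI.
apply: (@continuous_comp _ _ _ (deriv01 r) (fun v : V => v 0 j)).
  exact: cr.
exact: coord_continuous.
Qed.

Definition speed r (x : R) : R := enorm (deriv01 r (clampI x)).

Lemma continuous_speed r : is_C1 r -> continuous (speed r).
Proof.
move=> [_ cr] x.
apply: (@continuous_comp _ _ _ (@clampI R) (fun t => enorm (deriv01 r t))).
  exact: continuous_clampI.
apply: (@continuous_comp _ _ _ (deriv01 r) (@enorm R)); first exact: cr.
exact: continuous_enorm.
Qed.

Lemma coord_antideriv r j (t : I) : is_C1 r -> continuous r ->
  r t 0 j - r (I01_0 R) 0 j = antideriv (velocity r j) (val t).
Proof.
move=> C1r cr.
apply: (antideriv_of_quotient (h := fun t => r t 0 j)) => //.
- exact: continuous_velocity.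
- move=> u; apply: (@continuous_comp _ _ _ r (fun v : V => v 0 j)).
    exact: cr.
  exact: coord_continuous.
move=> u; have FF := dnbhs_I01_proper u.
rewrite velocity_val.
have H : diff_quotient r u @ u^' --> deriv01 r u by exact: C1r.1.
have := cvg_comp _ _ H (@coord_continuous R 1 3 0 j (deriv01 r u)).
by apply: cvg_trans; apply: near_eq_cvg; apply: nearW => s; rewrite /= /diff_quotient !mxE.
Qed.

Definition profile r : R -> R := antideriv (gauge (velocity r 0)).

(** The straight-line homotopy towards a monotone path on the segment AB. That path stands still
    where the gauge vanishes, hence the restriction to s < 1 in the results that follow. *)
Definition tighten s r : I -> V := fun t =>
  (1 - s) *: r t + (s * (profile r (val t) / profile r 1)) *: pointB R.

Lemma continuous_comb (u : I -> V) (w : I -> R) (a b k : R) :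
  continuous u -> continuous w ->
  continuous (fun t => a *: u t + (b * (w t / k)) *: pointB R).
Proof.
move=> cu cw t.
apply: (@continuousD _ V _ (fun t => a *: u t)
  (fun t => (b * (w t / k)) *: pointB R)); apply: continuousZ.
- exact: cst_continuous.
- exact: cu.
- apply: (@continuousM _ I (cst b) (fun t => w t / k)); first exact: cst_continuous.
  by apply: continuousM; [exact: cw|exact: cst_continuous].
- exact: cst_continuous.
Qed.

Section rope.
Variables (r : I -> V) (s : R).
Hypotheses (ropr : is_rope r).
Hypothesis short : antideriv (speed r) 1 < 3.
Hypotheses (s0 : 0 <= s) (s1 : s < 1).

Let C1r : is_C1 r. Proof. by case: ropr. Qed.
Let cr : continuous r.
Proof. by case: ropr => _ /topological_embedding_continuous. Qed.
Let cv j : continuous (velocity r j). Proof. exact: continuous_velocity. Qed.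
Let cg : continuous (gauge (velocity r 0)). Proof. exact: continuous_gauge. Qed.

Lemma antideriv_velocity01 : antideriv (velocity r 0) 1 = 1.
Proof.
rewrite -[X in antideriv _ X]/(val (I01_1 R)) -coord_antideriv//.
by case: ropr => _ _ _ -> ->; rewrite /pointA /pointB !mxE !eqxx subr0.
Qed.

(** The variation of the first coordinate is at most the length, hence below 3, while its rise is 1:
    this is the strict inequality required by [antideriv_gauge_gt0]. *)
Lemma profile1_gt0 : 0 < profile r 1.
Proof.
apply: antideriv_gauge_gt0 => //; rewrite antideriv_velocity01 mulr1.
apply: le_lt_trans short.
rewrite -[leLHS]subr0 -[leRHS]subr0 -[X in _ - X <= _](antideriv0 (fun x => `|velocity r 0 x|)).
rewrite -[X in _ <= _ - X](antideriv0 (speed r)).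
apply: le_antideriv => //; first exact: continuous_normf.
  exact: continuous_speed.
by move=> x _; exact: normr_coord0_le_enorm.
Qed.

Lemma tighten_deriv (t : I) : diff_quotient (tighten s r) t @ t^' -->
  (1 - s) *: deriv01 r t + (s * (gauge (velocity r 0) (val t) / profile r 1)) *: pointB R.
Proof.
have FF := dnbhs_I01_proper t.
have H : diff_quotient r t @ t^' --> deriv01 r t by exact: C1r.1.
have Hg := cvg_antideriv_quotient (t := t) cg.
have Hg' : s * (((val u - val t)^-1 * (profile r (val u) - profile r (val t))) / profile r 1)
    @[u --> t^'] --> s * (gauge (velocity r 0) (val t) / profile r 1).
  by apply: cvgM; [exact: cvg_cst|apply: cvgM; [exact: Hg|exact: cvg_cst]].
have -> : diff_quotient (tighten s r) t = fun u => (1 - s) *: diff_quotient r t u +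
    (s * (((val u - val t)^-1 * (profile r (val u) - profile r (val t))) / profile r 1))
      *: pointB R.
  apply/funext => u; rewrite /diff_quotient /tighten.
  by apply/rowP => j; rewrite !mxE; ring.
exact: (cvgD (cvgZ (cvg_cst (1 - s)) H) (cvgZ Hg' (cvg_cst (pointB R)))).
Qed.

Lemma deriv01_tighten (t : I) : deriv01 (tighten s r) t =
  (1 - s) *: deriv01 r t + (s * (gauge (velocity r 0) (val t) / profile r 1)) *: pointB R.
Proof. by have FF := dnbhs_I01_proper t; exact: cvg_lim (@tighten_deriv t). Qed.

Lemma tighten_C1 : is_C1 (tighten s r).
Proof.
split=> [t|t]; first by apply/cvg_ex; eexists; exact: tighten_deriv.
rewrite (_ : deriv01 _ = fun t =>
  (1 - s) *: deriv01 r t + (s * (gauge (velocity r 0) (val t) / profile r 1)) *: pointB R);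
  last by apply/funext; exact: deriv01_tighten.
apply: (continuous_comb (w := fun t : I => gauge (velocity r 0) (val t))) => //.
  exact: C1r.2.
move=> u; apply: continuous_comp; [exact: continuous_valI|exact: cg].
Qed.

Lemma tighten_continuous : continuous (tighten s r).
Proof.
apply: (continuous_comb (w := fun t : I => profile r (val t))) => // t.
apply: continuous_comp; first exact: continuous_valI.
have /andP[t0 _] := I01_itv t; apply: continuous_antideriv => //.
exact: lt_le_trans t0.
Qed.

(* Where the profile strictly increases so does the first coordinate of r, so
   the two summands cannot cancel. *)
Lemma tighten_inj_lt (t u : I) : val t < val u -> tighten s r t <> tighten s r u.
Proof.
move=> tu E; have /andP[t0 t1] := I01_itv t; have /andP[u0 u1] := I01_itv u.
have P0 := profile1_gt0.
have : profile r (val t) <= profile r (val u).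
  by apply: antideriv_nondecreasing => // [|x _]; [exact: ltW|exact: gauge_ge0].
rewrite le_eqVlt => /predU1P[Ptu|Ptu].
  move: E; rewrite /tighten Ptu => /addIr.
  have s10 : 1 - s != 0 by rewrite subr_eq0 gt_eqF.
  move=> /(scalerI s10).
  by case: ropr => _ [ir _] _ _ _ /ir tu'; rewrite tu' ltxx in tu.
have := gauge_increasing (@cv 0) t0 (ltW tu) u1 Ptu.
rewrite -!coord_antideriv// ltrD2r => ru.
have := congr1 (fun v : V => v 0 0) E; rewrite !mxE !eqxx !mulr1.
apply/eqP; rewrite lt_eqF//; apply: ltr_leD.
  by rewrite ltr_pM2l// subr_gt0.
apply: ler_wpM2l => //; apply: ler_wpM2r; first by rewrite invr_ge0 ltW.
exact: ltW.
Qed.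

Lemma tighten_is_rope : is_rope (tighten s r).
Proof.
have P0 := profile1_gt0; split.
- exact: tighten_C1.
- apply: injective_I01_embedding.
  + exact: norm_hausdorff.
  + exact: tighten_continuous.
  + move=> t u E; apply/val_inj; case: (ltgtP (val t) (val u)) => // tu.
      by have := tighten_inj_lt tu.
    by have := tighten_inj_lt tu; rewrite E.
- move=> t; rewrite deriv01_tighten.
  have g0 := gauge_ge0 (velocity r 0) (val t).
  (* Where the gauge vanishes the derivative is (1 - s) r'; elsewhere x' is at least the gauge, so
     the first coordinate of the derivative is positive. *)
  have [g|g] := eqVneq (gauge (velocity r 0) (val t)) 0.
    rewrite g mul0r mulr0 scale0r addr0 scaler_eq0 negb_or subr_eq0 gt_eqF//=.
    by case: ropr.
  have gp : 0 < gauge (velocity r 0) (val t) by rewrite lt_neqAle eq_sym g.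
  have := gauge_le_slope (@cv 0) (I01_itv t) (I01_itv t) gp.
  rewrite slope_diag// velocity_val => vg.
  apply/eqP => /(congr1 (fun v : V => v 0 0)); rewrite !mxE !eqxx !mulr1.
  apply/eqP; rewrite gt_eqF//; apply: ltr_pwDl.
    by rewrite mulr_gt0 ?subr_gt0//; exact: lt_le_trans vg.
  by rewrite mulr_ge0// divr_ge0// ltW.
- rewrite /tighten /profile antideriv0 mul0r mulr0 scale0r addr0.
  by case: ropr => _ _ _ -> _; rewrite /pointA scaler0.
- rewrite /tighten divff ?gt_eqF// mulr1.
  by case: ropr => _ _ _ _ ->; rewrite -scalerDl subrK scale1r.
Qed.

(** Integrate the pointwise bound of [enormDB_le]; the normalized gauge has integral 1 over
    [0, 1]. *)
Lemma tighten_length_le :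
  antideriv (speed (tighten s r)) 1 <= (1 - s) * antideriv (speed r) 1 + s.
Proof.
have P0 := profile1_gt0.
have cs := continuous_speed C1r.
have -> : (1 - s) * antideriv (speed r) 1 + s =
    antideriv (fun x => (1 - s) * speed r x + (s / profile r 1) * gauge (velocity r 0) x) 1.
  rewrite antideriv_lin//; congr (_ + _).
  by rewrite -[antideriv _ 1]/(profile r 1) divfK// gt_eqF.
rewrite -[leLHS]subr0 -[leRHS]subr0 -[X in _ - X <= _](antideriv0 (speed (tighten s r))).
rewrite -[X in _ <= _ - X](antideriv0 (fun x => (1 - s) * speed r x
  + (s / profile r 1) * gauge (velocity r 0) x)).
apply: le_antideriv.
- exact: continuous_speed tighten_C1.
- exact: continuous_lin.
- exact: lexx.
- exact: ler01.
move=> x x01; rewrite /speed deriv01_tighten val_clampI//.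
have g0 := gauge_ge0 (velocity r 0) x.
rewrite mulrA mulrAC.
apply: enormDB_le; first by rewrite subr_ge0 ltW.
by rewrite mulr_ge0// divr_ge0// ltW.
Qed.

End rope.

(** The extension by zero and the extension through [clampI] agree on [0, 1]. The difference of
    integrals in [antideriv] is the integral over ]0, 1], and the endpoint 0 is negligible. *)
Lemma Rintegral_speed r : is_C1 r ->
  \int[lebesgue_measure]_(t in `[0, 1]) enorm ('valL_0 (deriv01 r) t) =
  antideriv (speed r) 1.
Proof.
move=> C1r; have cs := continuous_speed C1r.
have int (a b : R) : lebesgue_measure.-integrable `[a, b] (EFin \o speed r).
  apply: continuous_compact_integrable; first exact: segment_compact.
  exact: continuous_subspaceT.
transitivity (\int[lebesgue_measure]_(t in `[0, 1]) speed r t).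
  apply: eq_Rintegral => x; rewrite inE/= in_itv/= => x01; congr (enorm _).
  by rewrite -[in LHS](val_clampI x01) -[LHS]/(sigL _ ('valL_0 (deriv01 r)) (clampI x)) valLK.
rewrite /antideriv Rintegral_itvB//; last 2 first.
  by rewrite bnd_simp lerN10.
  by rewrite bnd_simp.
rewrite Rintegral_itv_obnd_cbnd//.
by apply: integrableS (int 0 1) => //; apply: subset_itvr; rewrite bnd_simp.
Qed.

End tightening.

(** * Uniform convergence on [0, 1] *)

Section uniform_convergence.
Variables (R : realType) (Z : Type) (F : set_system Z).
Hypothesis FF : Filter F.
Notation I := (I01 R).

Definition ucvg (W : normedModType R) (f : Z -> I -> W) (f0 : I -> W) : Prop :=
  forall e : R, 0 < e -> \forall z \near F, forall t, `|f0 t - f z t| <= e.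

Lemma cvg_uniformP (W : normedModType R) (f : Z -> I -> W) (f0 : I -> W) :
  ((f : Z -> {uniform I -> W}) @ F --> (f0 : {uniform I -> W})) <-> ucvg f f0.
Proof.
split=> [cf e e0|uf P /uniform_nbhs[E [+ EP]]].
  have : nbhs (f0 : {uniform I -> W}) [set h : I -> W | forall t, `|f0 t - h t| <= e].
    apply/uniform_nbhs; exists [set xy | ball xy.1 e xy.2]; split.
      exact: (entourage_ball _ (PosNum e0)).
    by move=> h H t; apply/ltW; have := H t Logic.I; rewrite -ball_normE.
  exact: cf.
rewrite -entourage_ballE => -[e /= e0 eE].
have e20 : 0 < e / 2 by lra.
have := uf _ e20; apply: filterS => z H; apply: EP => t _.
by apply: eE => /=; rewrite -ball_normE/=; have := H t; lra.
Qed.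

Lemma ucvgD (W : normedModType R) (f g : Z -> I -> W) (f0 g0 : I -> W) :
  ucvg f f0 -> ucvg g g0 ->
  ucvg (fun z t => f z t + g z t) (fun t => f0 t + g0 t).
Proof.
move=> uf ug e e0; have e20 : 0 < e / 2 by lra.
apply: filterS2 (uf _ e20) (ug _ e20) => z Hf Hg t.
by rewrite opprD addrACA (le_trans (ler_normD _ _))// (splitr e) lerD.
Qed.

Lemma ucvgZ (W : normedModType R) (a : Z -> R) (a0 M : R)
    (f : Z -> I -> W) (f0 : I -> W) :
  a z @[z --> F] --> a0 -> ucvg f f0 -> (forall t, `|f0 t| <= M) ->
  ucvg (fun z t => a z *: f z t) (fun t => a0 *: f0 t).
Proof.
move=> ca uf f0M e e0.
have M0 : 0 <= M by exact: le_trans (f0M (I01_0 R)).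
(* [K] is a positive bound of [f0], and [A] eventually bounds [a z]; they control the two terms of
   (a0 - a) f0 + a (f0 - f). *)
pose K := M + 1; pose A : R := `|a0| + 1.
have K0 : 0 < K by rewrite /K; lra.
have A0 : 0 < A by rewrite /A; have := normr_ge0 a0; lra.
have d10 : 0 < e / (2 * K) by rewrite divr_gt0// mulr_gt0.
have d20 : 0 < e / (2 * A) by rewrite divr_gt0// mulr_gt0.
move/cvgrPdist_lt : ca => ca.
have := uf _ d20; have := ca _ d10; have := ca _ ltr01.
apply: filterS3 => z a1 ad fd t.
rewrite (_ : a0 *: f0 t - a z *: f z t = (a0 - a z) *: f0 t + a z *: (f0 t - f z t));
  last by rewrite scalerBl scalerBr addrA subrK.
apply: (le_trans (ler_normD _ _)); rewrite !normrZ (splitr e) lerD//.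
  rewrite (_ : e / 2 = e / (2 * K) * K); last by field; rewrite gt_eqF.
  apply: ler_pM => //; first exact: ltW.
  by apply: le_trans (f0M t) _; rewrite /K; lra.
rewrite (_ : e / 2 = A * (e / (2 * A))); last by field; rewrite gt_eqF.
apply: ler_pM => //; rewrite /A.
rewrite -[a z](subKr a0) (le_trans (ler_normB _ _))// lerD2l.
exact: ltW.
Qed.

Lemma ucvg_scaler (W : normedModType R) (f : Z -> I -> R) (f0 : I -> R) (w : W) :
  ucvg f f0 -> ucvg (fun z t => f z t *: w) (fun t => f0 t *: w).
Proof.
move=> uf e e0; pose K := `|w| + 1.
have K0 : 0 < K by rewrite /K; have := normr_ge0 w; lra.
apply: filterS (uf _ (divr_gt0 e0 K0)) => z H t.
rewrite -scalerBl normrZ (_ : e = e / K * K); last by rewrite divfK// gt_eqF.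
by apply: ler_pM => //; rewrite /K; lra.
Qed.

End uniform_convergence.

Lemma continuous_I01_bounded (R : realType) (W : normedModType R) (f : I01 R -> W) :
  continuous f -> exists M, forall t, `|f t| <= M.
Proof.
move=> cf; have : compact (range f).
  apply: (@continuous_compact _ _ f); last exact: compact_I01.
  exact: continuous_subspaceT.
move=> /compact_bounded[M [_ H]]; exists (M + 1) => t.
by apply: (H (M + 1)); [rewrite ltrDl|exists t].
Qed.

Lemma normr_coord_le (R : realType) (n : nat) (v : 'rV[R]_n.+1) (j : 'I_n.+1) :
  `|v 0 j| <= `|v|.
Proof.
by rewrite [leRHS]/Num.norm/= mx_normrE; apply/bigmax_geP; right; exists (0, j).
Qed.

(** * Tightening as a continuous map between spaces of ropes *)

Section tighten_rope.
Variable R : realType.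
Notation I := (I01 R).
Notation V := 'rV[R]_3.
Implicit Types (s : R) (r : Binfty R).

Definition curve r : I -> V := val (r : rope R).

Lemma curve_is_rope r : is_rope (curve r).
Proof. exact: set_valP. Qed.

Lemma curve_C1 r : is_C1 (curve r).
Proof. by have [] := curve_is_rope r. Qed.

Lemma curve_continuous r : continuous (curve r).
Proof.
by have [_ /topological_embedding_continuous] := curve_is_rope r.
Qed.

Lemma rope_lengthE r : rope_length r = antideriv (speed (curve r)) 1.
Proof. exact: Rintegral_speed (curve_C1 r). Qed.

(** The default r makes the map total; for length below 3 and 0 <= s < 1 it is excluded by
    [tighten_is_rope]. *)
Definition tighten_rope s r : Binfty R :=
  if pselect (is_rope (tighten s (curve r))) is left h
  then exist _ (tighten s (curve r)) (mem_set h) : rope R else r.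

Lemma curve_tighten_rope s r : rope_length r < 3 -> 0 <= s -> s < 1 ->
  curve (tighten_rope s r) = tighten s (curve r).
Proof.
rewrite rope_lengthE => L s0 s1; rewrite /tighten_rope; case: pselect => // nr.
by exfalso; apply: nr; exact: tighten_is_rope (curve_is_rope r) L s0 s1.
Qed.

Lemma tighten_rope_length s r : rope_length r < 3 -> 0 <= s -> s < 1 ->
  rope_length (tighten_rope s r) <= (1 - s) * rope_length r + s.
Proof.
move=> L s0 s1; rewrite !rope_lengthE curve_tighten_rope//.
by apply: tighten_length_le => //; [exact: curve_is_rope|rewrite -rope_lengthE].
Qed.

Lemma tighten_rope0 r : tighten_rope 0 r = r.
Proof.
rewrite /tighten_rope; case: pselect => // h; apply: val_inj => /=.
apply/funext => t; by rewrite /tighten mul0r scale0r addr0 subr0 scale1r.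
Qed.

Section continuity.
Variables (Z : topologicalType) (s : Z -> R) (r : Z -> Binfty R).
Hypotheses (cs : continuous s) (cr : continuous r).
Hypotheses (s01 : forall z, 0 <= s z < 1) (L : forall z, rope_length (r z) < 3).

Let r_cvg (z0 : Z) : ucvg (nbhs z0) (fun z => curve (r z)) (curve (r z0)).
Proof.
apply/cvg_uniformP.
have cj : {for z0, continuous (fun z => rope_jet (r z))}.
  by apply: continuous_comp; [exact: cr|exact: initial_continuous].
exact: (cvg_comp _ _ cj cvg_fst).
Qed.

Let dr_cvg (z0 : Z) :
  ucvg (nbhs z0) (fun z => deriv01 (curve (r z))) (deriv01 (curve (r z0))).
Proof.
apply/cvg_uniformP.
have cj : {for z0, continuous (fun z => rope_jet (r z))}.
  by apply: continuous_comp; [exact: cr|exact: initial_continuous].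
exact: (cvg_comp _ _ cj cvg_snd).
Qed.

Let velocity_near (z0 : Z) (e : R) : 0 < e -> \forall z \near z0,
  forall x, `|velocity (curve (r z0)) 0 x - velocity (curve (r z)) 0 x| <= e.
Proof.
move=> /(dr_cvg z0); apply: filterS => z H x.
apply: le_trans (H (clampI x)).
have := normr_coord_le (deriv01 (curve (r z0)) (clampI x) -
  deriv01 (curve (r z)) (clampI x)) 0.
by rewrite !mxE.
Qed.

Let cv (z : Z) : continuous (velocity (curve (r z)) 0).
Proof. exact: continuous_velocity (curve_C1 _). Qed.

Let gauge_cvg (z0 : Z) :
  ucvg (nbhs z0) (fun z (t : I) => gauge (velocity (curve (r z)) 0) (val t))
    (fun t => gauge (velocity (curve (r z0)) 0) (val t)).
Proof.
move=> e /(velocity_near z0); apply: filterS => z H t.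
by apply: gauge_dist => //; exact: cv.
Qed.

Let profile_near (z0 : Z) (e : R) : 0 < e -> \forall z \near z0,
  forall x, 0 <= x <= 1 -> `|profile (curve (r z0)) x - profile (curve (r z)) x| <= e.
Proof.
move=> /(velocity_near z0); apply: filterS => z H x x01.
apply: antideriv_dist => //; try exact: continuous_gauge (@cv _).
by move=> y y01; apply: gauge_dist => //; exact: cv.
Qed.

Let profile_cvg (z0 : Z) :
  ucvg (nbhs z0) (fun z (t : I) => profile (curve (r z)) (val t))
    (fun t => profile (curve (r z0)) (val t)).
Proof.
move=> e /(profile_near z0); apply: filterS => z H t.
by apply: H; exact: I01_itv.
Qed.

(** Length below 3 makes the normalizing constant nonzero, so the division is continuous. *)
Let coef_cvg (z0 : Z) :
  s z / profile (curve (r z)) 1 @[z --> z0] --> s z0 / profile (curve (r z0)) 1.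
Proof.
apply: cvgM; first exact: cs.
apply: cvgV.
  rewrite gt_eqF//; apply: profile1_gt0; first exact: curve_is_rope.
  by rewrite -rope_lengthE.
apply/cvgrPdist_le => e /(profile_near z0); apply: filterS => z; apply.
by rewrite ler01 lexx.
Qed.

(** The tightened rope and its derivative share this shape: (u, w) is the rope with its profile,
    respectively the derivative with the gauge. *)
Let comb_cvg (z0 : Z) (u : Z -> I -> V) (w : Z -> I -> R) :
  ucvg (nbhs z0) u (u z0) -> ucvg (nbhs z0) w (w z0) ->
  continuous (u z0) -> continuous (w z0) ->
  ucvg (nbhs z0)
    (fun z t => (1 - s z) *: u z t + (s z * (w z t / profile (curve (r z)) 1)) *: pointB R)
    (fun t => (1 - s z0) *: u z0 t +
       (s z0 * (w z0 t / profile (curve (r z0)) 1)) *: pointB R).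
Proof.
move=> uc wc cu cw.
have E z t : (s z * (w z t / profile (curve (r z)) 1)) *: pointB R =
    (s z / profile (curve (r z)) 1) *: (w z t *: pointB R).
  by rewrite scalerA mulrA mulrAC.
have [M HM] := continuous_I01_bounded cu.
have cwB : continuous (fun t => w z0 t *: pointB R).
  by move=> t; apply: continuousZ; [exact: cw|exact: cst_continuous].
have [N HN] := continuous_I01_bounded cwB.
have H : ucvg (nbhs z0)
    (fun z t => (1 - s z) *: u z t +
       (s z / profile (curve (r z)) 1) *: (w z t *: pointB R))
    (fun t => (1 - s z0) *: u z0 t +
       (s z0 / profile (curve (r z0)) 1) *: (w z0 t *: pointB R)).
  have c1 : 1 - s z @[z --> z0] --> 1 - s z0.
    by apply: cvgB; [exact: cvg_cst|exact: cs].
  apply: ucvgD; first exact: (ucvgZ _ c1 uc HM).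
  exact: (ucvgZ _ (@coef_cvg z0) (ucvg_scaler _ (pointB R) wc) HN).
move=> e /H; apply: filterS => z Hz t.
apply: le_trans (Hz t); rewrite le_eqVlt; apply/orP; left; apply/eqP;
by congr (`|(_ + _) - (_ + _)|); [exact: (E z0 t)|exact: (E z t)].
Qed.

(** The parameter space Z is arbitrary so as to serve both the homotopy inverse, with s constant,
    and the homotopies, where Z is a product with [0, 1]. *)
Lemma continuous_tighten_rope : continuous (fun z => tighten_rope (s z) (r z)).
Proof.
apply: continuous_comp_initial.
have ropr z := curve_is_rope (r z).
have short z : antideriv (speed (curve (r z))) 1 < 3 by rewrite -rope_lengthE.
pose T z : I -> V := tighten (s z) (curve (r z)).
(* In closed form the derivative falls under [comb_cvg], so both components of the jet converge
   uniformly. *)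
pose dT z : I -> V := fun t => (1 - s z) *: deriv01 (curve (r z)) t +
  (s z * (gauge (velocity (curve (r z)) 0) (val t) / profile (curve (r z)) 1)) *: pointB R.
have -> : @rope_jet R \o (fun z => tighten_rope (s z) (r z)) =
    fun z => (T z, dT z) :> {uniform I -> V} * {uniform I -> V}.
  apply/funext => z; case/andP: (s01 z) => s0 s1.
  have E : curve (tighten_rope (s z) (r z)) = T z by exact: curve_tighten_rope.
  have dE : deriv01 (curve (tighten_rope (s z) (r z))) = dT z.
    by rewrite E; apply/funext => t; exact: deriv01_tighten.
  by rewrite -E -dE.
move=> z0.
have U1 : ucvg (nbhs z0) T (T z0).
  have cP : continuous (fun t : I => profile (curve (r z0)) (val t)).
    move=> t; apply: continuous_comp; first exact: continuous_valI.
    have /andP[t0 _] := I01_itv t; apply: continuous_antideriv.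
      by move=> x; exact: (continuous_gauge (@cv z0)).
    exact: lt_le_trans t0.
  exact: (@comb_cvg z0 (fun z => curve (r z)) _ (@r_cvg z0)
    (@profile_cvg z0) (@curve_continuous (r z0)) cP).
have U2 : ucvg (nbhs z0) dT (dT z0).
  have cG : continuous (fun t : I => gauge (velocity (curve (r z0)) 0) (val t)).
    move=> t; apply: continuous_comp; first exact: continuous_valI.
    exact: (continuous_gauge (@cv z0)).
  exact: (@comb_cvg z0 (fun z => deriv01 (curve (r z))) _ (@dr_cvg z0)
    (@gauge_cvg z0) (curve_C1 (r z0)).2 cG).
have V1 : (T : Z -> {uniform I -> V}) @ z0 --> (T z0 : {uniform I -> V}).
  exact/cvg_uniformP.
have V2 : (dT : Z -> {uniform I -> V}) @ z0 --> (dT z0 : {uniform I -> V}).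
  exact/cvg_uniformP.
have FF : Filter (nbhs (z0 : Z)) by exact: nbhs_filter.
have FT : Filter (nbhs (T z0 : {uniform I -> V})) by exact: nbhs_filter.
have FdT : Filter (nbhs (dT z0 : {uniform I -> V})) by exact: nbhs_filter.
exact: (@cvg_pair _ _ _ _ _ _ FF FT FdT _ _ V1 V2).
Qed.

End continuity.

End tighten_rope.

(** * The homotopy inverse and the two homotopies *)

Theorem theorem1p4 (R : realType) (eps eps' : R)
    (eps_gt0 : 0 < eps) (eps_le : eps <= eps') (eps'_le2 : eps' <= 2) :
  homotopy_equivalence R (B_inclusion eps_le).
Proof.
have ci : continuous (B_inclusion eps_le).
  apply: continuous_comp_initial.
  rewrite (_ : _ \o _ = set_val); last exact/funext.
  exact: initial_continuous.
have length_lt3 (d : R) (z : B_ d) : d <= 2 -> rope_length (val z) < 3.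
  by move=> d2; have := set_valP z; rewrite /B_ /=; lra.
(* For s = 1 - eps / 2 the length bound (1 - s) L + s is below 1 + eps as soon
   as L < 3. *)
have eps'_gt0 : 0 < eps' by exact: (lt_le_trans eps_gt0 eps_le).
have eps2 : eps <= 2 by exact: (le_trans eps_le eps'_le2).
pose s0 : R := 1 - eps / 2.
have s0_ge0 : 0 <= s0 by rewrite /s0; lra.
have s0_lt1 : s0 < 1 by rewrite /s0; lra.
(* [homotopic] wants the composite at time 0 and the identity at time 1, so the tightening parameter
   decreases from [s0] to 0. *)
pose s (u : I01 R) : R := (1 - val u) * s0.
have s01 u : 0 <= s u < 1.
  have := I01_itv u; rewrite /s; move: (val u) => v /andP[v0 v1].
  by apply/andP; split; nra.
(* The bound (1 - s) L + s is a convex combination of L and 1, both below 1 + d. *)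
have tighten_B (d : R) (z : B_ d) (u : I01 R) : 0 < d -> d <= 2 ->
    B_ d (tighten_rope (s u) (val z)).
  move=> d0 d2; have L := length_lt3 d z d2; case/andP: (s01 u) => su0 su1.
  apply: le_lt_trans (tighten_rope_length L su0 su1) _.
  have := set_valP z; rewrite /B_ /=; nra.
(* Taken at d = eps and d = eps', this gives both homotopies: at time 0 it tightens by [s0], as the
   inverse map does. *)
pose H (d : R) (d0 : 0 < d) (d2 : d <= 2) (zu : B_ d * I01 R) : B_ d :=
  SigSub (mem_set (tighten_B d zu.1 zu.2 d0 d2)).
have cs : continuous s.
  move=> u; apply: (@continuousM _ (I01 R) (fun u => 1 - val u) (cst s0)).
    by apply: continuousB; [exact: cst_continuous|exact: continuous_valI].
  exact: cst_continuous.
have cH (d : R) (d0 : 0 < d) (d2 : d <= 2) : continuous (H d d0 d2).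
  apply: continuous_comp_initial.
  apply: (continuous_tighten_rope (s := s \o snd) (r := set_val \o fst)).
  - move=> zu; by apply: continuous_comp; [exact: cvg_snd|exact: cs].
  - move=> zu; apply: continuous_comp; first exact: cvg_fst.
    exact: initial_continuous.
  - by move=> zu; exact: s01.
  - by move=> zu; exact: length_lt3.
have H0 (z : B_ eps') : B_ eps (tighten_rope s0 (val z)).
  have L := length_lt3 eps' z eps'_le2.
  have short (l : R) : l < 3 -> (1 - s0) * l + s0 < 1 + eps.
    by move=> l3; rewrite /s0; nra.
  exact: le_lt_trans (tighten_rope_length L s0_ge0 s0_lt1) (short _ L).
split=> //; exists (fun z => SigSub (mem_set (H0 z))); split.
- apply: continuous_comp_initial.
  apply: (continuous_tighten_rope (s := cst s0) (r := set_val)).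
  + by move=> z; exact: cst_continuous.
  + exact: initial_continuous.
  + by move=> z; rewrite /= s0_ge0.
  + by move=> z; exact: length_lt3.
- exists (H eps eps_gt0 eps2); split; first exact: cH.
  + by move=> z; apply: val_inj; rewrite /= /s subr0 mul1r.
  + by move=> z; apply: val_inj; rewrite /= /s subrr mul0r tighten_rope0.
- exists (H eps' eps'_gt0 eps'_le2); split; first exact: cH.
  + by move=> z; apply: val_inj; rewrite /= /s subr0 mul1r.
  + by move=> z; apply: val_inj; rewrite /= /s subrr mul0r tighten_rope0.
Qed.
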